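(* Let $\Gamma=(X,R)$ be a bipartite distance-regular graph with diameter $D\ge4$ and valency $k\ge3$, fix $x\in X$, and let $W$ be a thin irreducible $T(x)$-module with endpoint $2$ and local eigenvalue $\eta$ with $\tilde\theta_1<\eta<\tilde\theta_d$. Then $W$ has dimension $D-1$. For $0\le i\le D$, $E^*_iW$ is zero if $i\in\{0,1\}$ and has dimension $1$ if $2\le i\le D$. Moreover $E_iW$ is zero if $i\in\{0,D\}$ and has dimension $1$ if $1\le i\le D-1$.
   Context: $\Gamma$ is a finite connected bipartite distance-regular graph with distance $\partial$, intersection numbers $c_i,b_i$; $A_i$ distance matrices, $A=A_1$, eigenvalues $\theta_0>\dots>\theta_D$, $E_i$ primitive idempotent for $\theta_i$; $d=\lfloor D/2\rfloor$. $E^*_i$ diagonal with $(y,y)$-entry $1$ if $\partial(x,y)=i$, else $0$; $T(x)$ generated by $A,E^*_0,\dots,E^*_D$; $T$-modules are $T$-invariant subspaces of $\mathbb{C}^X$; thin: $\dim E^*_iW\le1$ for all $i$; endpoint $\min\{i:E^*_iW\ne0\}$; local eigenvalue of thin irreducible $W$ with endpoint 2: eigenvalue of $E^*_2A_2E^*_2$ on $E^*_2W$. $\tilde\theta_1=-1-b_2b_3(\theta_1^2-b_2)^{-1}$, $\tilde\theta_d=-1-b_2b_3(\theta_d^2-b_2)^{-1}$. *)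

(* Defs.v *)
From HB Require Import structures.
From mathcomp Require Import all_boot all_order all_algebra.
From mathcomp Require Import reals.
From mathcomp.real_closed Require Import complex.

Set Implicit Arguments.
Unset Strict Implicit.
Unset Printing Implicit Defensive.

Import Order.TTheory GRing.Theory Num.Theory.
Local Open Scope ring_scope.

Definition simple_graph (X : finType) (e : rel X) : Prop :=
  symmetric e /\ irreflexive e.

Definition connected_graph (X : finType) (e : rel X) : Prop :=
  forall y z : X, connect e y z.

Definition bipartite (X : finType) (e : rel X) : Prop :=
  exists S : {set X}, forall y z : X, e y z -> (y \in S) != (z \in S).

Definition has_walk (X : finType) (e : rel X) (n : nat) (y z : X) : bool :=
  [exists p : n.-tuple X, path e y p && (last y p == z)].

(* The least length of a walk from y to z. In a connected graph this is < #|X|;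
   the value #|X| is returned if there is no walk. *)
Definition dist (X : finType) (e : rel X) (y z : X) : nat :=
  find (fun n => has_walk e n y z) (iota 0 #|X|).

Definition diameter (X : finType) (e : rel X) : nat :=
  (\max_(y : X) \max_(z : X) dist e y z)%N.

Definition valency (X : finType) (e : rel X) (k : nat) : Prop :=
  forall y : X, #|[set z | e y z]| = k.

(* [p h i j] is the intersection number usually written p^h_{ij}; it is
   constrained only for h <= diameter e. *)
Definition distance_regular (X : finType) (e : rel X)
    (p : nat -> nat -> nat -> nat) : Prop :=
  connected_graph e /\
  forall (h i j : nat) (y z : X), dist e y z = h ->
    #|[set w | (dist e y w == i) && (dist e w z == j)]| = p h i j.

Definition b_ (p : nat -> nat -> nat -> nat) (i : nat) : nat := p i 1%N i.+1.

(* Matrices with rows and columns indexed by X are matrices over 'I_#|X|, the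
   vertex of index i being [enum_val i]. *)
Section Matrices.

Variables (C : numClosedFieldType) (X : finType) (e : rel X).

Definition dist_mx (i : nat) : 'M[C]_#|X| :=
  \matrix_(a, b) (dist e (enum_val a) (enum_val b) == i)%:R.

Definition adj_mx : 'M[C]_#|X| := dist_mx 1.

Definition dual_idem (x : X) (i : nat) : 'M[C]_#|X| :=
  \matrix_(a, b) ((a == b) && (dist e x (enum_val a) == i))%:R.

(* theta_0 > ... > theta_D are all the distinct eigenvalues of the graph. The
   order of C only compares numbers with a real difference. *)
Definition ordered_eigenvalues (theta : nat -> C) : Prop :=
  (forall a : C, eigenvalue adj_mx a <->
     exists2 i : nat, (i <= diameter e)%N & a = theta i) /\
  (forall i j : nat, (i < j <= diameter e)%N -> theta j < theta i).

End Matrices.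

Inductive gen_alg (C : numClosedFieldType) (n : nat) (G : 'M[C]_n -> Prop) :
    'M[C]_n -> Prop :=
  | gen_alg_gen B of G B : gen_alg G B
  | gen_alg_one : gen_alg G 1%:M
  | gen_alg_add B1 B2 of gen_alg G B1 & gen_alg G B2 : gen_alg G (B1 + B2)
  | gen_alg_scale a B of gen_alg G B : gen_alg G (a *: B)
  | gen_alg_mul B1 B2 of gen_alg G B1 & gen_alg G B2 : gen_alg G (B1 *m B2).

Definition mx_img (C : numClosedFieldType) (n : nat) (B : 'M[C]_n)
    (W : {vspace 'cV[C]_n}) : {vspace 'cV[C]_n} :=
  (linfun (mulmx B) @: W)%VS.

Section Modules.

Variables (C : numClosedFieldType) (X : finType) (e : rel X).

Definition bose_mesner : 'M[C]_#|X| -> Prop :=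
  gen_alg (fun B => B = adj_mx C e).

Definition primitive_idempotents (theta : nat -> C)
    (E : nat -> 'M[C]_#|X|) : Prop :=
  [/\ forall i, (i <= diameter e)%N -> bose_mesner (E i) /\ E i <> 0,
      forall i j, (i <= diameter e)%N -> (j <= diameter e)%N ->
        E i *m E j = if i == j then E i else 0,
      \sum_(i < (diameter e).+1) E i = 1%:M &
      forall i, (i <= diameter e)%N -> adj_mx C e *m E i = theta i *: E i].

Variable x : X.

Definition terwilliger : 'M[C]_#|X| -> Prop :=
  gen_alg (fun B => B = adj_mx C e \/
    exists2 i, (i <= diameter e)%N & B = dual_idem C e x i).

Definition T_module (W : {vspace 'cV[C]_#|X|}) : Prop :=
  forall B, terwilliger B -> (mx_img B W <= W)%VS.

Definition T_irreducible (W : {vspace 'cV[C]_#|X|}) : Prop :=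
  [/\ T_module W, W <> 0%VS &
      forall U, T_module U -> (U <= W)%VS -> U = 0%VS \/ U = W].

Definition thin (W : {vspace 'cV[C]_#|X|}) : Prop :=
  forall i, (i <= diameter e)%N -> (\dim (mx_img (dual_idem C e x i) W) <= 1)%N.

Definition has_endpoint (W : {vspace 'cV[C]_#|X|}) (r : nat) : Prop :=
  [/\ (r <= diameter e)%N, mx_img (dual_idem C e x r) W <> 0%VS &
      forall i, (i < r)%N -> mx_img (dual_idem C e x i) W = 0%VS].

(* For W thin with endpoint 2 the space E*_2 W is a line, so that eta is
   determined by W. *)
Definition local_eigenvalue (W : {vspace 'cV[C]_#|X|}) (eta : C) : Prop :=
  exists2 v, v \in mx_img (dual_idem C e x 2) W & v != 0 /\
    dual_idem C e x 2 *m dist_mx C e 2 *m dual_idem C e x 2 *m v = eta *: v.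

End Modules.

Definition theta_tilde (C : numClosedFieldType) (p : nat -> nat -> nat -> nat)
    (t : C) : C :=
  -1 - (b_ p 2)%:R * (b_ p 3)%:R * (t ^+ 2 - (b_ p 2)%:R)^-1.

(* Main.v *)
(** Let [v] span [E*_2 W]. An element of the Bose-Mesner algebra has entries
    [f (dist y z)], and for an idempotent [E_i] the numbers [f h] satisfy the
    three-term recurrence [theta_i f(h) = c_h f(h-1) + b_h f(h+1)]. Two vertices
    of the second sphere around [x] are at distance 0, 2 or 4, and the entries
    of [v] sum to zero, so that on this sphere
    [E_i v = ((f 0 - f 2) + (1 + eta) (f 2 - f 4)) v]; by the recurrence the
    factor is a positive multiple of
    [f 0 (k^2 - theta_i^2) (b_2 b_3 + (1 + eta) (theta_i^2 - b_2))]. Summing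
    over [i] and using [sum_i E_i = 1] shows that [b_2] is a weighted mean of
    the [theta_i^2] with [0 < i < D], whence [theta_d^2 < b_2 < theta_1^2], and
    the hypothesis on [eta] makes the last factor positive. Thus [E_i W] is
    nonzero for [0 < i < D], which gives [dim W >= D - 1], while thinness gives
    [dim W <= D - 1]. *)

Require Import Defs.
From mathcomp Require Import all_boot all_order all_algebra.
From mathcomp Require Import reals.
From mathcomp.real_closed Require Import complex.
From mathcomp Require Import ring lra zify.
Import Order.TTheory GRing.Theory Num.Theory.
Local Open Scope ring_scope.

Set Implicit Arguments.
Unset Strict Implicit.
Unset Printing Implicit Defensive.

(** * Distances in a bipartite distance-regular graph *)

Section Distance.

Variables (X : finType) (e : rel X).
Implicit Types x y z w : X.

Lemma has_walkP n y z :
  reflect (exists s : seq X, [/\ size s = n, path e y s & last y s = z])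
          (has_walk e n y z).
Proof.
apply: (iffP existsP) => [[s /andP[ps /eqP ls]]|[s [ss ps ls]]].
  by exists s; rewrite size_tuple.
by exists (tcast ss (in_tuple s)); rewrite val_tcast /= ps ls eqxx.
Qed.

Hypothesis e_sym : symmetric e.
Hypothesis e_irr : irreflexive e.
Hypothesis e_conn : connected_graph e.

(** A walk can be shortened to one without repeated vertices, of length less than [#|X|], so the
    search in [dist] succeeds and its default value never occurs. *)
Lemma dist_walk y z : has_walk e (dist e y z) y z.
Proof.
have hasw : has (fun n => has_walk e n y z) (iota 0 #|X|).
  have /connectP[s ps ->] := e_conn y z; case/shortenP: ps => s' ps' us' _.
  apply/hasP; exists (size s'); last by apply/has_walkP; exists s'.
  rewrite mem_iota /= add0n -[(size s').+1]/(size (y :: s')) -(card_uniqP us').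
  exact: max_card.
have := nth_find 0%N hasw; rewrite nth_iota ?add0n //.
by move: hasw; rewrite has_find size_iota.
Qed.

Lemma dist_le n y z : has_walk e n y z -> (dist e y z <= n)%N.
Proof.
move=> wn; rewrite leqNgt; apply/negP => nd.
have := before_find 0%N nd; rewrite nth_iota ?add0n ?wn //.
by apply: leq_trans nd _; rewrite -[leqRHS](size_iota 0) find_size.
Qed.

Lemma distxx y : dist e y y = 0%N.
Proof. by apply/eqP; rewrite -leqn0; apply/dist_le/has_walkP; exists [::]. Qed.

Lemma dist_eq0 y z : (dist e y z == 0%N) = (y == z).
Proof.
apply/eqP/eqP => [d0|->]; last exact: distxx.
by have /has_walkP[s []] := dist_walk y z; rewrite d0; case: s.
Qed.

Lemma dist_triangle y w z : (dist e y z <= dist e y w + dist e w z)%N.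
Proof.
have /has_walkP[s [<- ps ls]] := dist_walk y w.
have /has_walkP[t [<- pt lt]] := dist_walk w z.
apply/dist_le/has_walkP; exists (s ++ t).
by rewrite size_cat cat_path last_cat ls ps pt.
Qed.

Lemma dist_eq1 y z : (dist e y z == 1%N) = e y z.
Proof.
apply/idP/idP => [/eqP d1|eyz].
  have /has_walkP[[|w [|? ?]] []] := dist_walk y z; rewrite d1 //=.
  by rewrite andbT => _ eyw <-.
rewrite eqn_leq lt0n dist_eq0; apply/andP; split.
  by apply/dist_le/has_walkP; exists [:: z]; rewrite /= eyz.
by apply/eqP => yz; rewrite yz e_irr in eyz.
Qed.

Lemma has_walk_sym n y z : has_walk e n y z -> has_walk e n z y.
Proof.
case/has_walkP=> s [ss ps ls]; apply/has_walkP.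
exists (rev (belast y s)); split; first by rewrite size_rev size_belast.
  by rewrite -ls rev_path (eq_path (e' := e)) // => u v; rewrite e_sym.
by case: s ps ls {ss} => [|u s] //= _ _; rewrite rev_cons last_rcons.
Qed.

Lemma distC y z : dist e y z = dist e z y.
Proof. by apply/eqP; rewrite eqn_leq !dist_le // has_walk_sym ?dist_walk. Qed.

Lemma dist_le_diameter y z : (dist e y z <= diameter e)%N.
Proof.
apply: leq_trans (leq_bigmax y).
exact: (leq_bigmax (F := fun z => dist e y z) z).
Qed.

Lemma dist_pred h y z : dist e y z = h.+1 ->
  exists2 w, e y w & dist e w z = h.
Proof.
move=> dh; have /has_walkP[[|w s] []] := dist_walk y z; rewrite dh //=.
case=> ss /andP[eyw ps] ls; exists w => //; apply/eqP; rewrite eqn_leq.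
rewrite dist_le; last by apply/has_walkP; exists s.
move: eyw; rewrite -dist_eq1 => /eqP d1.
by have := dist_triangle y w z; rewrite dh d1.
Qed.

Lemma dist_attained (x : X) h : (h <= diameter e)%N ->
  exists y z, dist e y z = h.
Proof.
(* Induction on [diameter e - h]: start from a pair at maximal distance and drop the first vertex of
   a shortest walk at each step. The vertex [x] makes the maxima range over a nonempty set. *)
move=> hD; suff [y [z]] :
    exists y z, dist e y z = (diameter e - (diameter e - h))%N.
  by rewrite subKn // => yz; exists y, z.
elim: (diameter e - h)%N => [|n [y [z yz]]].
  rewrite subn0 /diameter.
  have X_gt0 : (0 < #|X|)%N by apply/card_gt0P; exists x.
  have [y _ ->] := eq_bigmax_cond (fun y : X => \max_(z : X) dist e y z)%N X_gt0.
  have [z _ ->] := eq_bigmax_cond (fun z : X => dist e y z) X_gt0.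
  by exists y, z.
case E: (diameter e - n)%N yz => [|m] yz.
  by exists y, z; rewrite yz; lia.
by have [w _ wz] := dist_pred yz; exists w, z; rewrite wz; lia.
Qed.

Hypothesis e_bip : bipartite e.

(** Every edge changes side of the bipartition, so the parity of a distance records whether its two
    ends lie on different sides. *)
Lemma odd_dist_triangle y w z :
  odd (dist e y z) = odd (dist e y w) (+) odd (dist e w z).
Proof.
have [S SP] := e_bip.
have odd_dist u v : odd (dist e u v) = (u \in S) (+) (v \in S).
  have /has_walkP[s [<- ps <-]] := dist_walk u v.
  elim: s u ps => [|a s IHs] u /=; first by rewrite addbb.
  move=> /andP[eua /IHs ->]; have := SP _ _ eua.
  by case: (u \in S); case: (a \in S); case: (last a s \in S).
by rewrite !odd_dist addbA -(addbA (y \in S)) addbb addbF.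
Qed.

(** The triangle inequality allows a change of at most 1, and parity rules out equality. *)
Lemma dist_adj y w z : e y w ->
  dist e w z = (dist e y z).+1 \/ (dist e w z).+1 = dist e y z.
Proof.
move=> eyw; have := eyw; rewrite -dist_eq1 => /eqP d1.
have := dist_triangle y w z; have := dist_triangle w y z.
have := odd_dist_triangle y w z; rewrite (distC w y) d1 => oyz.
have : dist e y z <> dist e w z by move=> E; move: oyz; rewrite E; case: odd.
lia.
Qed.

Variable p : nat -> nat -> nat -> nat.
Hypothesis e_drg : distance_regular e p.

Lemma intersection_numberE h i j y z : dist e y z = h ->
  #|[set w | (dist e y w == i) && (dist e w z == j)]| = p h i j.
Proof. exact: (proj2 e_drg). Qed.

Lemma b_gt0 (x : X) h : (h < diameter e)%N -> (0 < b_ p h)%N.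
Proof.
move=> hD; have [y [z yz]] := dist_attained x hD.
have [w eyw wz] := dist_pred yz.
rewrite /b_ -(intersection_numberE _ _ wz); apply/card_gt0P; exists y.
by rewrite inE dist_eq1 e_sym eyw yz eqxx.
Qed.

Lemma c1E (x : X) : (1 <= diameter e)%N -> p 1 1 0 = 1%N.
Proof.
move=> D1; have [y [z yz]] := dist_attained x D1.
rewrite -(intersection_numberE _ _ yz) -[RHS](cards1 z); apply: eq_card => w.
by rewrite !inE dist_eq0; have [->|_] := eqVneq w z; rewrite ?yz ?andbF.
Qed.

Variable k : nat.
Hypothesis e_val : valency e k.

(** Each neighbour of [y] is one step nearer to [z] or one step farther. For [h = 0] the truncated
    [h.-1] gives [p 0 1 0], which counts nothing. *)
Lemma cbE (x : X) h : (h <= diameter e)%N -> (p h 1 h.-1 + b_ p h)%N = k.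
Proof.
move=> hD; have [y [z yz]] := dist_attained x hD.
rewrite -(e_val y) /b_ -!(intersection_numberE _ _ yz) -cardsUI.
rewrite [X in (_ + X)%N](_ : _ = 0%N); last first.
  by apply: eq_card0 => w; rewrite !inE; apply/negP; lia.
rewrite addn0; apply: eq_card => w; rewrite !inE -andb_orr dist_eq1.
case eyw: (e y w) => //=; case: (dist_adj z eyw); rewrite yz => d.
  by rewrite d eqxx orbT.
by rewrite -d /= eqxx.
Qed.

Lemma c0E (x : X) : p 0 1 0 = 0%N.
Proof.
rewrite -(intersection_numberE _ _ (distxx x)); apply: eq_card0 => w; rewrite !inE.
rewrite dist_eq0; apply/negP => /andP[/[swap]/eqP->].
by rewrite distxx.
Qed.

(** The left side is an entry of [A] times a matrix whose entries depend only on distance; this is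
    the source of the three-term recurrence. *)
Lemma sum_dist_adj (C : numClosedFieldType) (f : nat -> C) h y z :
  dist e y z = h ->
  \sum_w (dist e y w == 1%N)%:R * f (dist e w z) =
  (p h 1 h.-1)%:R * f h.-1 + (b_ p h)%:R * f h.+1.
Proof.
move=> yz; rewrite /b_ -!(intersection_numberE _ _ yz).
rewrite -!sum1_card !natr_sum !mulr_suml.
rewrite [X in _ = X + _]big_mkcond [X in _ = _ + X]big_mkcond -big_split /=.
apply: eq_bigr => w _; rewrite !inE dist_eq1.
case eyw: (e y w); rewrite /= ?mul0r ?addr0 // mul1r.
case: (dist_adj z eyw); rewrite yz => d.
  by rewrite d eqxx (_ : (h.+1 == h.-1) = false) /= ?add0r ?mul1r //; lia.
by rewrite -d /= eqxx (_ : (dist e w z == _.+2) = false) /= ?addr0 ?mul1r //; lia.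
Qed.

End Distance.

(** * Complete families of orthogonal idempotents *)

Section Images.

Variables (C : numClosedFieldType) (n : nat).
Implicit Types (W : {vspace 'cV[C]_n}) (B : 'M[C]_n).

Lemma mem_mx_img B W v : v \in W -> B *m v \in mx_img B W.
Proof. by move=> vW; apply/memv_imgP; exists v => //; rewrite lfunE. Qed.

Lemma mx_imgP B W u : u \in mx_img B W -> exists2 v, v \in W & u = B *m v.
Proof. by case/memv_imgP=> v vW ->; exists v => //; rewrite lfunE. Qed.

Lemma mx_img_eq0P B W :
  mx_img B W = 0%VS <-> forall v, v \in W -> B *m v = 0.
Proof.
split=> [B0 v vW|B0]; first by apply/eqP; rewrite -memv0 -B0 mem_mx_img.
apply/eqP; rewrite -subv0; apply/subvP => u /mx_imgP[v vW ->].
by rewrite B0 ?mem0v.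
Qed.

(** [W] is the direct sum of the images [P i W]. This serves both for the [E_i] and for the
    [E*_i]. *)
Lemma dim_orthogonal_idempotents N (P : nat -> 'M[C]_n) W :
  (forall i j, (i <= N)%N -> (j <= N)%N ->
     P i *m P j = if i == j then P i else 0) ->
  \sum_(i < N.+1) P i = 1%:M ->
  (forall i, (i <= N)%N -> (mx_img (P i) W <= W)%VS) ->
  \dim W = (\sum_(i < N.+1) \dim (mx_img (P i) W))%N.
Proof.
move=> Porth Psum PW.
have W_sum : W = (\sum_(i < N.+1) mx_img (P i) W)%VS.
  apply/eqP; rewrite eqEsubv; apply/andP; split; last first.
    by apply/subv_sumP => i _; apply: PW; rewrite -ltnS.
  apply/subvP => v vW; rewrite -[v]mul1mx -Psum mulmx_suml.
  by apply: memv_sumr => i _; apply: mem_mx_img.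
rewrite {1}W_sum; apply/directvP; apply/directv_sum_independent => us usP us0 i _.
have us_fix (j : 'I_N.+1) : P j *m us j = us j.
  have /mx_imgP[v _ ->] := usP j isT.
  by rewrite mulmxA Porth ?leq_ord // eqxx.
(* Applying [P i] to the relation [us0] kills every summand except [us i]. *)
rewrite -(us_fix i) -[RHS](mulmx0 1 (P i)) -us0 mulmx_sumr (bigD1 i) //=.
rewrite big1 ?addr0 // => j ji; rewrite -(us_fix j) mulmxA Porth ?leq_ord //.
by rewrite eq_sym (inj_eq val_inj) (negPf ji) mul0mx.
Qed.

End Images.

(** * A real inequality for a decreasing sequence symmetric about 0 *)

(* Applied with [b = b_2], [B = b_2 b_3] and [m i] the diagonal entry of [E_i]. *)
Lemma local_bound_gt0 (F : realFieldType) (D : nat) (t m : nat -> F)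
    (k b B eta : F) :
  (4 <= D)%N -> 0 <= B ->
  (forall i j, (i < j <= D)%N -> t j < t i) ->
  (forall i, (i <= D)%N -> t (D - i)%N = - t i) -> t 0%N = k ->
  (forall i, (i <= D)%N -> 0 < m i) ->
  \sum_(i < D.+1) m i * (k ^+ 2 - t i ^+ 2) * (t i ^+ 2 - b) = 0 ->
  -1 - B * (t 1%N ^+ 2 - b)^-1 < eta -> eta < -1 - B * (t D./2 ^+ 2 - b)^-1 ->
  forall i, (1 <= i <= D - 1)%N -> 0 < B + (1 + eta) * (t i ^+ 2 - b).
Proof.
move=> D4 B0 tdec tN t0 m0 sum0 eta1 etad.
have tle i j : (i <= j <= D)%N -> t j <= t i.
  rewrite leq_eqVlt => /andP[/orP[/eqP-> //|ij jD]].
  by apply/ltW/tdec; rewrite ij.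
have lt_k i : (1 <= i <= D - 1)%N -> 0 < k ^+ 2 - t i ^+ 2.
  move=> iD; have ti0 : t i < k by rewrite -t0 tdec //; lia.
  have tiD : - k < t i.
    by have := tdec i (D - 0)%N; rewrite (tN 0%N) // t0; apply; lia.
  by nra.
have sq_le1 i : (1 <= i <= D - 1)%N -> t i ^+ 2 <= t 1%N ^+ 2.
  move=> iD; have ti1 : t i <= t 1%N by apply: tle; lia.
  have tiD : - t 1%N <= t i by rewrite -tN; [apply: tle|]; lia.
  by nra.
(* Since [t (D - d) = - t d] with [d = D./2], the value [t d] is nonnegative. Indices up to [d] have
   [t i >= t d], the later ones [t i <= - t d]. *)
have sq_ged i : (1 <= i <= D - 1)%N -> t D./2 ^+ 2 <= t i ^+ 2.
  move=> iD; have dN := tN D./2 ltac:(lia).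
  have d0 : t (D - D./2)%N <= t D./2 by apply: tle; lia.
  have [id|di] := leqP i D./2.
    by have := tle i D./2 ltac:(lia); nra.
  by have := tle (D - D./2)%N i ltac:(lia); nra.
(* At most two of the distinct numbers [t 1], [t 2], [t 3] can share a square; [D >= 4] keeps the
   index 3 in range. *)
have term0 : (forall i, (1 <= i <= D - 1)%N -> t i ^+ 2 = b) -> False.
  move=> tb; have [t12 t23] : t 2%N < t 1%N /\ t 3%N < t 2%N.
    by split; apply: tdec; lia.
  have [] := (tb 1%N ltac:(lia), tb 2%N ltac:(lia)).
  have := tb 3%N ltac:(lia) => t3 t1 t2.
  have : (t 1%N - t 2%N) * (t 1%N + t 2%N) = 0 by ring: t1 t2.
  have : (t 2%N - t 3%N) * (t 2%N + t 3%N) = 0 by ring: t3 t2.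
  by move=> /eqP + /eqP; rewrite !mulf_eq0 !subr_eq0 (gt_eqF t12) (gt_eqF t23)
    /= => /eqP ? /eqP ?; lra.
have ends i : (i <= D)%N -> ~~ (1 <= i <= D - 1)%N -> k ^+ 2 - t i ^+ 2 = 0.
  move=> iD iN; have [->|->] : i = 0%N \/ i = (D - 0)%N by lia.
    by rewrite t0 subrr.
  by rewrite tN // t0 sqrrN subrr.
(* If all [t i ^+ 2 - b] had the same sign, the terms of the vanishing sum would too, and each would
   be 0. The sign [s] is [-1] to refute [t 1 ^+ 2 <= b], and [1] to refute [b <= t d ^+ 2]. *)
have zero (s : F) : s != 0 ->
    (forall i, (1 <= i <= D - 1)%N -> 0 <= s * (t i ^+ 2 - b)) ->
    forall i, (1 <= i <= D - 1)%N -> t i ^+ 2 = b.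
  move=> s0 sP.
  have nneg (i : 'I_D.+1) : true ->
      0 <= s * (m i * (k ^+ 2 - t i ^+ 2) * (t i ^+ 2 - b)).
    move=> _; have iD : (i <= D)%N by rewrite -ltnS.
    have [iin|iout] := boolP (1 <= i <= D - 1)%N; last first.
      by rewrite ends // mulr0 mul0r mulr0.
    by rewrite mulrCA mulr_ge0 ?sP // mulr_ge0 // ltW ?m0 ?lt_k.
  move=> i iD; have [iD0 iD1] : (i <= D)%N /\ (i < D.+1)%N by lia.
  move/(congr1 (fun z => s * z)): sum0; rewrite mulr0 mulr_sumr.
  move/(psumr_eq0P nneg)/(_ (Ordinal iD1) isT)/eqP => /=.
  rewrite !mulf_eq0 (negPf s0) (gt_eqF (m0 i iD0)) (gt_eqF (lt_k i iD)) /=.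
  by rewrite subr_eq0 => /eqP.
have lt1 : b < t 1%N ^+ 2.
  rewrite ltNge; apply/negP => le1; apply: term0; apply: (zero (-1)).
    by rewrite oppr_eq0 oner_eq0.
  by move=> i /sq_le1 ?; lra.
have ltd : t D./2 ^+ 2 < b.
  rewrite ltNge; apply/negP => led; apply: term0; apply: (zero 1).
    exact: oner_neq0.
  by move=> i /sq_ged ?; lra.
(* The goal is affine in [t i ^+ 2], so positivity at the two extreme squares is enough. Clearing
   denominators in the bounds on [eta] gives it there; the second denominator is negative, which
   reverses the inequality. *)
move=> i iD; have := sq_le1 i iD; have := sq_ged i iD.
have : 0 < B + (1 + eta) * (t 1%N ^+ 2 - b).
  move: eta1; rewrite -subr_gt0 in lt1.
  rewrite -(ltr_pM2r lt1) mulrBl -mulrA mulVf ?gt_eqF //; lra.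
have : 0 < B + (1 + eta) * (t D./2 ^+ 2 - b).
  move: etad; rewrite -subr_lt0 in ltd.
  rewrite -(ltr_nM2r ltd) mulrBl -mulrA mulVf ?lt_eqF //; lra.
move: (t i ^+ 2) (t 1%N ^+ 2) (t D./2 ^+ 2) lt1 ltd => s s1 sd ? ? ? ? ? ?.
by have [h|h] := lerP 0 (1 + eta); nra.
Qed.

(** * The Bose-Mesner algebra and the spectrum *)

Section Radial.

Variables (C : numClosedFieldType) (X : finType) (e : rel X).
Variables (p : nat -> nat -> nat -> nat) (k : nat) (x : X).
Hypothesis e_sym : symmetric e.
Hypothesis e_irr : irreflexive e.
Hypothesis e_drg : distance_regular e p.
Hypothesis e_bip : bipartite e.
Hypothesis e_val : valency e k.
Implicit Types (f g : nat -> C) (t : C).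

Let e_conn : connected_graph e := proj1 e_drg.
Notation D := (diameter e).

(** The combination of the distance matrices with coefficients [f h]; only the values up to the
    diameter matter. *)
Definition radial_mx f : 'M[C]_#|X| :=
  \matrix_(a, b) f (dist e (enum_val a) (enum_val b)).

Lemma sum_vertices (F : X -> C) :
  \sum_(a < #|X|) F (enum_val a) = \sum_w F w.
Proof. by rewrite -big_enum_val. Qed.

(** Sort the middle vertex [w] by its distances to the two ends: the class sizes are intersection
    numbers, which depend on the ends only through their distance. *)
Lemma radial_mxM f g : radial_mx f *m radial_mx g =
  radial_mx (fun h => \sum_(i < D.+1) \sum_(j < D.+1) (p h i j)%:R * (f i * g j)).
Proof.
apply/matrixP => a b; rewrite !mxE.
set y := enum_val a; set z := enum_val b.
under eq_bigr => c _ do rewrite !mxE.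
rewrite (sum_vertices (fun w => f (dist e y w) * g (dist e w z))).
transitivity (\sum_w \sum_(i < D.+1) \sum_(j < D.+1)
    ((dist e y w == i) && (dist e w z == j))%:R * (f i * g j)).
  apply: eq_bigr => w _.
  have iD : (dist e y w < D.+1)%N by rewrite ltnS dist_le_diameter.
  have jD : (dist e w z < D.+1)%N by rewrite ltnS dist_le_diameter.
  rewrite (bigD1 (Ordinal iD)) //= (bigD1 (Ordinal jD)) //= !eqxx mul1r.
  rewrite big1 => [|j]; last first.
    by rewrite -(inj_eq val_inj) /= eq_sym => /negPf ->; rewrite mul0r.
  rewrite big1 ?addr0 // => i.
  rewrite -(inj_eq val_inj) /= eq_sym => /negPf ->.
  by rewrite big1 // => j _; rewrite mul0r.
rewrite exchange_big; apply: eq_bigr => i _ /=.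
rewrite exchange_big; apply: eq_bigr => j _ /=.
rewrite -mulr_suml -(intersection_numberE e_drg _ _ erefl) -sum1_card natr_sum.
congr (_ * _); rewrite [RHS]big_mkcond.
by apply: eq_bigr => w _; rewrite inE; case: ifP.
Qed.

Lemma bose_mesner_radial B : bose_mesner e B -> exists f, B = radial_mx f.
Proof.
elim=> [_ ->||_ _ _ [f ->] _ [g ->]|a _ _ [f ->]|_ _ _ [f ->] _ [g ->]].
- by exists (fun h => (h == 1%N)%:R).
- exists (fun h => (h == 0%N)%:R); apply/matrixP => a b.
  by rewrite !mxE (dist_eq0 e_conn) (inj_eq enum_val_inj).
- by exists (fun h => f h + g h); apply/matrixP => a b; rewrite !mxE.
- by exists (fun h => a * f h); apply/matrixP => b c; rewrite !mxE.
- by rewrite radial_mxM; eexists.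
Qed.

Lemma radial_mxE f y z :
  radial_mx f (enum_rank y) (enum_rank z) = f (dist e y z).
Proof. by rewrite !mxE !enum_rankK. Qed.

(** At [h = 0] this is [p 0 1 0 = 0], so that the recurrence holds there too, with a spurious term
    of coefficient 0. *)
Definition c_ h := p h 1 h.-1.

Lemma radial_rec f t : adj_mx C e *m radial_mx f = t *: radial_mx f ->
  forall h, (h <= D)%N ->
    t * f h = (c_ h)%:R * f h.-1 + (b_ p h)%:R * f h.+1.
Proof.
move=> Af h /(dist_attained e_irr e_conn x)[y [z yz]].
rewrite -(sum_dist_adj e_sym e_irr e_conn e_bip e_drg f yz).
move/matrixP/(_ (enum_rank y) (enum_rank z)): Af.
rewrite !mxE !enum_rankK yz => <-; rewrite -sum_vertices.
by apply: eq_bigr => w _; rewrite !mxE !enum_rankK.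
Qed.

Let c0 : c_ 0 = 0%N := c0E e_conn e_drg x.

(** * Consequences of the three-term recurrence *)

Section Recurrence.

Variables (f : nat -> C) (t : C).
Hypothesis rec : forall h, (h <= D)%N ->
  t * f h = (c_ h)%:R * f h.-1 + (b_ p h)%:R * f h.+1.

Let b_neq0 h : (h < D)%N -> (b_ p h)%:R != 0 :> C.
Proof. by rewrite pnatr_eq0 -lt0n; apply: (b_gt0 e_sym e_irr e_conn e_drg x). Qed.

Let cb h : (h <= D)%N -> (c_ h)%:R + (b_ p h)%:R = k%:R :> C.
Proof.
by move=> hD; rewrite -natrD (cbE e_sym e_irr e_conn e_bip e_drg e_val x hD).
Qed.

Let rec_next h : (h < D)%N ->
  f h.+1 = (t * f h - (c_ h)%:R * f h.-1) / (b_ p h)%:R.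
Proof.
by move=> hD; rewrite (rec (ltnW hD)) addrC addKr mulrC mulKf // b_neq0.
Qed.

(** Induction adapted to a recurrence that looks back two places; for [h = 0] both premises are
    [P 0]. *)
Let ind2 (P : nat -> Prop) : P 0%N ->
  (forall h, (h < D)%N -> P h.-1 -> P h -> P h.+1) ->
  forall h, (h <= D)%N -> P h.
Proof.
move=> P0 PS; elim/ltn_ind=> -[|h] IH // hD; apply: PS => //; apply: IH; lia.
Qed.

(** The recurrence is linear with real coefficients and determines [f] from [f 0], which itself may
    still be a non-real number. *)
Lemma rec_real : t \is Num.real -> forall h, (h <= D)%N ->
  exists2 r, r \is Num.real & f h = f 0%N * r.
Proof.
move=> t_real; apply: ind2 => [|h hD [r r_real fr] [s s_real fs]].
  by exists 1; rewrite ?mulr1.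
exists ((t * s - (c_ h)%:R * r) / (b_ p h)%:R); last first.
  by rewrite rec_next // fr fs; ring.
by rewrite !(rpredM, rpredB, rpredV, realn) //; rewrite realn.
Qed.

(** For [t = k] or [t = -k] the sequence [s ^+ h] solves the recurrence, because [c_h + b_h = k] and
    [s ^+ 2 = 1]. *)
Lemma rec_sign s : s ^+ 2 = 1 -> t = s * k%:R ->
  forall h, (h <= D)%N -> f h = s ^+ h * f 0%N.
Proof.
move=> s2 tE; apply: ind2 => [|h hD fp fh]; first by rewrite mul1r.
apply: (mulfI (b_neq0 hD)); rewrite mulrC rec_next // divfK ?b_neq0 //.
rewrite tE -(cb (ltnW hD)) fp fh exprS.
case: h {hD fp fh} => [|h] /=; first by rewrite c0; ring.
apply/eqP; rewrite -subr_eq0 !exprS; apply/eqP.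
move: (c_ _)%:R (b_ p _)%:R (s ^+ h) => c b q.
transitivity ((s ^+ 2 - 1) * c * q * f 0%N); first by ring.
by rewrite s2 subrr !mul0r.
Qed.

Hypothesis D4 : (4 <= D)%N.

Let c1 : (c_ 1)%:R = 1 :> C.
Proof. by rewrite /c_ (c1E e_irr e_conn e_drg x) //; lia. Qed.

(** Elimination of [f 1] from the recurrence at 0 and 1. *)
Lemma rec_12 :
  k%:R * (b_ p 1)%:R * (f 0%N - f 2) = (k%:R ^+ 2 - t ^+ 2) * f 0%N.
Proof.
have r0 := rec (h := 0) isT; have r1 := rec (h := 1) ltac:(lia).
have k0 := cb (h := 0) isT; have k1 := cb (h := 1) ltac:(lia).
rewrite c0 /= !add0r ?mul0r ?add0r in r0 k0; rewrite c1 /= in r1 k1.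
rewrite k0 in r0; rewrite mul1r in r1.
have b1E : (b_ p 1)%:R = k%:R - 1 :> C by rewrite -k1 addrC addKr.
rewrite b1E in r1 *; apply/eqP; rewrite -subr_eq0; apply/eqP.
transitivity (t * (t * f 0%N - k%:R * f 1%N)
  + k%:R * (t * f 1%N - (f 0%N + (k%:R - 1) * f 2))); first by ring.
by rewrite r0 r1 !subrr !mulr0 addr0.
Qed.

Lemma rec_24 : (b_ p 2)%:R * (b_ p 3)%:R * (f 2 - f 4) =
  (f 0%N - f 2) * (t ^+ 2 - (b_ p 2)%:R).
Proof.
have r1 := rec (h := 1) ltac:(lia); have r2 := rec (h := 2) ltac:(lia).
have r3 := rec (h := 3) ltac:(lia).
have k0 := cb (h := 0) isT; have k1 := cb (h := 1) ltac:(lia).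
have k2 := cb (h := 2) ltac:(lia); have k3 := cb (h := 3) ltac:(lia).
rewrite c1 /= in r1 k1; rewrite /= in r2 r3.
have := rec_12.
have -> : (b_ p 1)%:R = k%:R - 1 :> C by rewrite -k1 addrC addKr.
have c2E : (c_ 2)%:R = k%:R - (b_ p 2)%:R :> C by rewrite -k2 addrK.
have c3E : (c_ 3)%:R = k%:R - (b_ p 3)%:R :> C by rewrite -k3 addrK.
have b1E : (b_ p 1)%:R = k%:R - 1 :> C by rewrite -k1 addrC addKr.
rewrite c2E in r2; rewrite c3E in r3; rewrite b1E mul1r in r1.
move: (b_ p 2)%:R (b_ p 3)%:R k%:R (f 0%N) (f 1%N) (f 2) (f 3) (f 4) r1 r2 r3
  => b2 b3 K f0 f1 f2 f3 f4 r1 r2 r3 r0.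
apply/eqP; rewrite -subr_eq0; apply/eqP.
(* The difference of the two sides is a combination of [rec_12] and the recurrence at 1, 2 and 3,
   with multipliers chosen to eliminate [f1] and [f3]. *)
transitivity (((K ^+ 2 - t ^+ 2) * f0 - K * (K - 1) * (f0 - f2))
  + (K - b2) * (t * f1 - (f0 + (K - 1) * f2))
  + t * (t * f2 - ((K - b2) * f1 + b2 * f3))
  + b2 * (t * f3 - ((K - b3) * f2 + b3 * f4))).
  by ring.
by rewrite r0 r1 r2 r3 !subrr !mulr0 !addr0.
Qed.

End Recurrence.

(* The diagonal entry of [f = f * f] reads
   [f 0 = sum_w f (dist x w) ^+ 2], and all the ratios [f h / f 0] are real. *)
Lemma radial_idempotent_gt0 f t : t \is Num.real ->
  adj_mx C e *m radial_mx f = t *: radial_mx f ->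
  radial_mx f *m radial_mx f = radial_mx f -> radial_mx f <> 0 -> 0 < f 0%N.
Proof.
move=> t_real Af ff f_neq0; have f_real := rec_real (radial_rec Af) t_real.
have f0_neq0 : f 0%N != 0.
  apply/eqP => f0; apply: f_neq0; apply/matrixP => a b; rewrite !mxE.
  have [r _ ->] := f_real _ (dist_le_diameter e (enum_val a) (enum_val b)).
  by rewrite f0 mul0r.
rewrite lt0r f0_neq0 -invr_ge0.
(* As [f 0] is not yet known to be real, the diagonal identity is divided by [f 0 ^+ 2], which
   leaves squares of real ratios. *)
have -> : (f 0%N)^-1 = \sum_w (f (dist e x w) / f 0%N) ^+ 2.
  apply: (mulfI (expf_neq0 2 f0_neq0)).
  rewrite {1}expr2 mulfK // mulr_sumr.
  rewrite -{1}(distxx e x) -radial_mxE -ff mxE -sum_vertices.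
  apply: eq_bigr => w _; rewrite !mxE !enum_rankK (distC e_sym e_conn (enum_val w)).
  by rewrite -expr2 -exprMn [f 0%N * _]mulrC divfK.
apply: sumr_ge0 => w _; rewrite real_exprn_even_ge0 //.
have [r r_real ->] := f_real _ (dist_le_diameter e x w).
by rewrite mulrC mulKf.
Qed.

(** On distances 0, 2 and 4, [f] equals [(f 0 - f 4) [d = 0] + (f 2 - f 4) [d = 2] + f 4]. The three
    parts act on [v] as a scalar, as a multiple of [eta], and as 0. *)
Lemma radial_mul_sphere2 f (v : 'cV[C]_#|X|) eta :
  (forall a, dist e x (enum_val a) != 2 -> v a 0 = 0) ->
  \sum_a v a 0 = 0 ->
  (forall a, dist e x (enum_val a) = 2 ->
     (dist_mx C e 2 *m v) a 0 = eta * v a 0) ->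
  forall a, dist e x (enum_val a) = 2 ->
    (radial_mx f *m v) a 0 =
      ((f 0%N - f 2) + (1 + eta) * (f 2 - f 4)) * v a 0.
Proof.
move=> v_supp v_sum v_eta a xa.
transitivity (\sum_b ((f 0%N - f 4) * ((b == a)%:R * v b 0)
   + (f 2 - f 4) * (dist_mx C e 2 a b * v b 0) + f 4 * v b 0)).
  rewrite mxE; apply: eq_bigr => b _; rewrite !mxE.
  have [xb|/v_supp->] := eqVneq (dist e x (enum_val b)) 2;
    last by rewrite !mulr0 !addr0.
  set d := dist e _ _; have d4 : (d <= 4)%N.
    by have := dist_triangle e_conn (enum_val a) x (enum_val b);
       rewrite (distC e_sym e_conn _ x) xa xb.
  have : ~~ odd d.
    by rewrite /d (odd_dist_triangle e_conn e_bip _ x) (distC e_sym e_conn _ x)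
      xa xb.
  have -> : (b == a) = (d == 0%N).
    by rewrite /d (dist_eq0 e_conn) (inj_eq enum_val_inj) eq_sym.
  by case: d d4 => [|[|[|[|[|d]]]]] //= _ _; ring.
rewrite !big_split /= -!mulr_sumr v_sum mulr0 addr0.
rewrite (bigD1 a) //= eqxx mul1r big1 ?addr0; last first.
  by move=> b /negPf->; rewrite mul0r.
have := v_eta a xa; rewrite mxE => ->; ring.
Qed.

(** Parity of distances is additive, so every row of the matrix is the row of [x] up to a power of
    [s]. *)
Lemma radial_sign_mul0 f s (w : 'cV[C]_#|X|) : s ^+ 2 = 1 ->
  (forall h, (h <= D)%N -> f h = s ^+ h * f 0%N) ->
  (radial_mx f *m w) (enum_rank x) 0 = 0 -> radial_mx f *m w = 0.
Proof.
move=> s2 fs fwx; apply/colP => a; rewrite [RHS]mxE.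
have s_odd n : s ^+ n = s ^+ odd n.
  by rewrite -{1}(odd_double_half n) exprD -mul2n exprM s2 expr1n mulr1.
transitivity (s ^+ dist e (enum_val a) x * (radial_mx f *m w) (enum_rank x) 0);
  last by rewrite fwx mulr0.
rewrite !mxE mulr_sumr; apply: eq_bigr => b _; rewrite !mxE enum_rankK mulrA.
congr (_ * _); rewrite fs ?dist_le_diameter // [in RHS]fs ?dist_le_diameter //.
rewrite mulrA -exprD s_odd [in RHS]s_odd oddD.
by rewrite -(odd_dist_triangle e_conn e_bip).
Qed.

(** * The eigenvalues: reality, maximum and symmetry *)

Lemma adj_mx_sym a b : adj_mx C e a b = adj_mx C e b a.
Proof. by rewrite !mxE (distC e_sym e_conn). Qed.

Lemma adj_mx_row_sum a : \sum_b adj_mx C e a b = k%:R.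
Proof.
under eq_bigr => b _ do rewrite mxE.
rewrite (sum_vertices (fun w => (dist e (enum_val a) w == 1%N)%:R)).
rewrite -(e_val (enum_val a)) -sum1_card natr_sum [RHS]big_mkcond.
by apply: eq_bigr => w _; rewrite inE (dist_eq1 e_irr e_conn); case: ifP.
Qed.

Lemma eigenvalue_valency : eigenvalue (adj_mx C e) k%:R.
Proof.
apply/eigenvalueP; exists (const_mx 1).
  apply/rowP => b; rewrite !mxE mulr1 -(adj_mx_row_sum b).
  by apply: eq_bigr => a _; rewrite mxE mul1r adj_mx_sym.
by apply/eqP => /rowP/(_ (enum_rank x))/eqP; rewrite !mxE oner_eq0.
Qed.

(** Negating an eigenvector on one side of the bipartition negates its eigenvalue. *)
Lemma eigenvalueN t : eigenvalue (adj_mx C e) t -> eigenvalue (adj_mx C e) (- t).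
Proof.
have [S SP] := e_bip; case/eigenvalueP => v vA v0.
pose sg (a : 'I_#|X|) : C := (-1) ^+ (enum_val a \in S).
have sg0 a : sg a != 0 by rewrite expf_neq0 // oppr_eq0 oner_eq0.
apply/eigenvalueP; exists (\row_a (sg a * v 0 a)).
  apply/rowP => b; move/rowP/(_ b): vA; rewrite !mxE => vAb.
  transitivity (- sg b * \sum_a v 0 a * adj_mx C e a b); last by rewrite vAb; ring.
  rewrite mulr_sumr; apply: eq_bigr => a _; rewrite !mxE (dist_eq1 e_irr e_conn).
  case eab: (e _ _); rewrite ?mulr0 // !mulr1; congr (_ * _).
  have := SP _ _ eab; rewrite /sg.
  by case: (enum_val a \in S); case: (enum_val b \in S) => //= _;
    rewrite ?expr0 ?expr1 ?opprK.
apply: contraNneq v0 => /rowP v0; apply/eqP/rowP => a.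
by apply: (mulfI (sg0 a)); have := v0 a; rewrite !mxE mulr0.
Qed.

(** Compare the sums of absolute values of [t v] and [v A]; all row sums of [A] are [k]. *)
Lemma eigenvalue_norm_le t : eigenvalue (adj_mx C e) t -> `|t| <= k%:R.
Proof.
case/eigenvalueP => v vA v0.
have S_gt0 : 0 < \sum_a `|v 0 a|.
  rewrite lt0r sumr_ge0 ?andbT //; apply: contraNneq v0.
  move/(psumr_eq0P (fun a _ => normr_ge0 (v 0 a))) => va.
  by apply/eqP/rowP => a; rewrite mxE; apply/normr0_eq0/va.
rewrite -(ler_pM2r S_gt0) !mulr_sumr.
apply: (@le_trans _ _ (\sum_b \sum_a `|v 0 a| * adj_mx C e a b)).
  apply: ler_sum => b _; rewrite -normrM; move/rowP/(_ b): vA; rewrite !mxE => <-.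
  apply: le_trans (ler_norm_sum _ _ _) _; apply: ler_sum => a _.
  by rewrite normrM mxE normr_nat.
rewrite exchange_big; apply: ler_sum => a _ /=.
by rewrite -mulr_sumr adj_mx_row_sum mulrC.
Qed.

Section Spectrum.

Variable theta : nat -> C.
Hypothesis theta_eig : ordered_eigenvalues e theta.

Lemma theta_eigenvalue i : (i <= D)%N -> eigenvalue (adj_mx C e) (theta i).
Proof. by move=> iD; apply/(proj1 theta_eig); exists i. Qed.

(** The real number [k] is one of the [theta j], and comparable numbers differ by a real. *)
Lemma theta_real i : (i <= D)%N -> theta i \is Num.real.
Proof.
have [j jD kj] : exists2 j, (j <= D)%N & k%:R = theta j.
  exact/(proj1 theta_eig)/eigenvalue_valency.
have j_real : theta j \is Num.real by rewrite -kj realn.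
move=> iD; have [ij|ji|->//] := ltngtP i j.
  rewrite -(subrK (theta j) (theta i)) realD // ger0_real // subr_ge0 ltW //.
  by apply: (proj2 theta_eig); rewrite ij.
rewrite -(subKr (theta j) (theta i)) realB // ger0_real // subr_ge0 ltW //.
by apply: (proj2 theta_eig); rewrite ji.
Qed.

Lemma theta0 : theta 0%N = k%:R.
Proof.
have [j jD kj] : exists2 j, (j <= D)%N & k%:R = theta j.
  exact/(proj1 theta_eig)/eigenvalue_valency.
case: j jD kj => [//|j] jD kj.
have : k%:R < theta 0%N by rewrite kj; apply: (proj2 theta_eig).
rewrite le_gtF //; apply: le_trans (real_ler_norm (theta_real _)) _ => //.
exact: eigenvalue_norm_le (theta_eigenvalue _).
Qed.

Lemma thetaN i : (i <= D)%N -> theta (D - i)%N = - theta i.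
Proof.
have neg j : (j <= D)%N -> exists2 l, (l <= D)%N & - theta j = theta l.
  by move=> jD; apply/(proj1 theta_eig)/eigenvalueN/theta_eigenvalue.
have lt_theta j l : (j <= D)%N -> (l <= D)%N -> theta j < theta l -> (l < j)%N.
  move=> jD lD; rewrite ltnNge; apply: contraTN; rewrite leq_eqVlt.
  case/orP => [/eqP->|jl]; first by rewrite ltxx.
  apply/negP => /(lt_trans (proj2 theta_eig j l _)).
  by rewrite jl lD ltxx => /(_ isT).
(* Negation reverses the order. Raising [j] by 1 lowers the index of the negative strictly, so
   induction from [j = 0] bounds [j + l] above; [down], from [j = D], bounds it below. *)
have up j l : (j <= D)%N -> (l <= D)%N -> - theta j = theta l -> (j + l <= D)%N.
  elim: j l => [|j IH] l jD lD jl //.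
  have [l' l'D jl'] := neg j (ltnW jD).
  have := IH l' (ltnW jD) l'D jl'.
  have : (l < l')%N; last by lia.
  by apply: lt_theta => //; rewrite -jl -jl' ltrN2; apply: (proj2 theta_eig); lia.
have down n j l : (j + n = D)%N -> (l <= D)%N -> - theta j = theta l ->
    (D <= j + l)%N.
  elim: n j l => [|n IH] j l jn lD jl; first by lia.
  have [l' l'D jl'] := neg j.+1 ltac:(lia).
  have := IH j.+1 l' ltac:(lia) l'D jl'.
  have : (l' < l)%N; last by lia.
  by apply: lt_theta => //; rewrite -jl -jl' ltrN2; apply: (proj2 theta_eig); lia.
move=> iD; have [l lD il] := neg i iD.
have := up i l iD lD il; have := down (D - i)%N i l ltac:(lia) lD il.
by rewrite il => ? ?; congr theta; lia.
Qed.

End Spectrum.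

End Radial.

(** * The Terwilliger algebra *)

Section DualIdempotents.

Variables (C : numClosedFieldType) (X : finType) (e : rel X) (x : X).

Lemma mul_dual_idem i (v : 'cV[C]_#|X|) a :
  (dual_idem C e x i *m v) a 0 = (dist e x (enum_val a) == i)%:R * v a 0.
Proof.
rewrite mxE (bigD1 a) //= big1 => [|b ba]; first by rewrite mxE eqxx addr0.
by rewrite mxE eq_sym (negPf ba) mul0r.
Qed.

Lemma dual_idemM i j : dual_idem C e x i *m dual_idem C e x j =
  if i == j then dual_idem C e x i else 0.
Proof.
apply/matrixP => a b; rewrite mxE (bigD1 a) //= big1 => [|c ca]; last first.
  by rewrite mxE eq_sym (negPf ca) mul0r.
rewrite addr0 !mxE eqxx /= -natrM mulnb; have [<-|ij] := eqVneq i j.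
  by rewrite !mxE; case: (a == b); case: eqP.
by rewrite mxE; case: (a == b); case: eqP => // ->; rewrite (negPf ij).
Qed.

Lemma sum_dual_idem :
  \sum_(i < (diameter e).+1) dual_idem C e x i = 1%:M.
Proof.
apply/matrixP => a b; rewrite summxE mxE.
have aD : (dist e x (enum_val a) < (diameter e).+1)%N.
  by rewrite ltnS dist_le_diameter.
rewrite (bigD1 (Ordinal aD)) //= big1 => [|i]; first by rewrite mxE eqxx andbT addr0.
rewrite mxE -(inj_eq val_inj) /= eq_sym => /negPf->.
by rewrite andbF.
Qed.

Lemma bose_mesner_terwilliger (B : 'M[C]_#|X|) : bose_mesner e B -> terwilliger e x B.
Proof.
elim=> [_ ->||B1 B2 _ IH1 _ IH2|a B1 _ IH|B1 B2 _ IH1 _ IH2].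
- by apply: gen_alg_gen; left.
- exact: gen_alg_one.
- exact: gen_alg_add.
- exact: gen_alg_scale.
- exact: gen_alg_mul.
Qed.

End DualIdempotents.

(** * Counting dimensions *)

Lemma eq_of_sum_leq n (F G : nat -> nat) :
  (forall i, (i <= n)%N -> (F i <= G i)%N) ->
  (\sum_(i < n.+1) G i <= \sum_(i < n.+1) F i)%N ->
  forall i, (i <= n)%N -> F i = G i.
Proof.
move=> FG GF i i_n.
have [le_sum] := leqif_sum (P := xpredT)
  (fun (j : 'I_n.+1) _ => leqif_eq (FG j (leq_ord j))).
rewrite eqn_leq le_sum GF => /esym/forallP/(_ (Ordinal (i_n : (i < n.+1)%N))) /=.
by move/eqP.
Qed.

(** The upper bounds on [F] and the lower bounds on [G] both add up to [D - 1]. This squeezes [N],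
    and every bound is then attained. *)
Lemma dims_of_sums D (F G : nat -> nat) (N : nat) : (1 <= D)%N ->
  N = (\sum_(i < D.+1) F i)%N -> N = (\sum_(i < D.+1) G i)%N ->
  (forall i, (i <= D)%N -> (F i <= (2 <= i))%N) ->
  (forall i, (i <= D)%N -> ((1 <= i <= D - 1) <= G i)%N) ->
  [/\ N = (D - 1)%N, forall i, (i <= D)%N -> F i = (2 <= i)%N &
      forall i, (i <= D)%N -> G i = (1 <= i <= D - 1)%N].
Proof.
move=> D1 NF NG F_le G_ge.
have sum2 n : (\sum_(i < n.+1) (2 <= i) = n - 1)%N.
  elim: n => [|n IH]; first by rewrite big_ord_recl big_ord0.
  by rewrite big_ord_recr /= IH; lia.
have sum1 n m : (\sum_(i < n.+1) (1 <= i <= m) = minn n m)%N.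
  elim: n => [|n IH]; first by rewrite big_ord_recl big_ord0 min0n.
  by rewrite big_ord_recr /= IH; lia.
have NF_le : (N <= D - 1)%N.
  by rewrite NF -sum2; apply: leq_sum => i _; rewrite F_le ?leq_ord.
have NG_ge : (D - 1 <= N)%N.
  have -> : (D - 1 = minn D (D - 1))%N by lia.
  by rewrite NG -sum1; apply: leq_sum => i _; rewrite G_ge ?leq_ord.
have NE : N = (D - 1)%N by lia.
split=> // i iD.
  by apply: (eq_of_sum_leq (G := fun i => (2 <= i)%N) F_le) => //; rewrite sum2 -NF NE.
apply/esym/(eq_of_sum_leq (F := fun i => (1 <= i <= D - 1)%N) G_ge) => //.
by rewrite sum1 -NG NE; lia.
Qed.

(** * Dimensions of [W] and of its components [E*_i W] and [E_i W] *)

Unset Implicit Arguments.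
Set Strict Implicit.
Set Printing Implicit Defensive.

Theorem theorem16p8 (R : realType) (X : finType) (e : rel X)
    (p : nat -> nat -> nat -> nat) (D k : nat)
    (theta : nat -> R[i]) (E : nat -> 'M[R[i]]_#|X|)
    (x : X) (W : {vspace 'cV[R[i]]_#|X|}) (eta : R[i]) :
  simple_graph e -> bipartite e -> distance_regular e p ->
  diameter e = D -> (4 <= D)%N ->
  valency e k -> (3 <= k)%N ->
  ordered_eigenvalues e theta ->
  primitive_idempotents e theta E ->
  T_irreducible e x W -> thin e x W -> has_endpoint e x W 2 ->
  local_eigenvalue e x W eta ->
  theta_tilde p (theta 1%N) < eta ->
  eta < theta_tilde p (theta D./2) ->
  [/\ \dim W = (D - 1)%N,
      forall i, (i <= D)%N ->
        (i \in [:: 0; 1]%N -> mx_img (dual_idem R[i] e x i) W = 0%VS) /\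
        ((2 <= i <= D)%N -> \dim (mx_img (dual_idem R[i] e x i) W) = 1%N) &
      forall i, (i <= D)%N ->
        (i \in [:: 0%N; D] -> mx_img (E i) W = 0%VS) /\
        ((1 <= i <= D - 1)%N -> \dim (mx_img (E i) W) = 1%N)].
Proof.
move=> [e_sym e_irr] e_bip e_drg diamD D4 e_val k3 theta_eig.
move=> [E_bm E_orth E_sum AE] [TW _ _] thinW [_ _ W_end] [v v_in [v_neq0 v_eta]].
move=> eta1 etad; subst D; set D := diameter e in D4 etad *.
have e_conn := proj1 e_drg.
have dual_W i : (i <= D)%N -> (mx_img (dual_idem R[i] e x i) W <= W)%VS.
  by move=> iD; apply: TW; apply: gen_alg_gen; right; exists i.
have E_W i : (i <= D)%N -> (mx_img (E i) W <= W)%VS.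
  by move=> iD; apply/TW/bose_mesner_terwilliger; case: (E_bm i iD).
have vW : v \in W by apply: (subvP (dual_W 2 _)) => //; lia.
have v_supp a : dist e x (enum_val a) != 2 -> v a 0 = 0.
  move=> /negPf xa; have [u _ ->] := mx_imgP v_in.
  by rewrite mul_dual_idem xa mul0r.
have E_radial i : (i <= D)%N -> exists f, [/\ E i = radial_mx e f, 0 < f 0%N &
    forall h, (h <= D)%N ->
      theta i * f h = (c_ p h)%:R * f h.-1 + (b_ p h)%:R * f h.+1].
  move=> iD; have [Ei_bm Ei_neq0] := E_bm i iD.
  have [f Ef] := bose_mesner_radial e_drg Ei_bm; exists f.
  have Af := AE i iD; have ff := E_orth i i iD iD; rewrite eqxx Ef in ff.
  rewrite Ef in Af Ei_neq0.
  split=> //; last exact: (radial_rec x e_sym e_irr e_drg e_bip Af).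
  have t_real := theta_real x e_sym e_irr e_drg e_val theta_eig iD.
  exact: (radial_idempotent_gt0 x e_sym e_irr e_drg e_bip t_real Af ff Ei_neq0).
have th0 : theta 0%N = k%:R := theta0 x e_sym e_irr e_drg e_val theta_eig.
have thN i : (i <= D)%N -> theta (D - i)%N = - theta i.
  exact: (thetaN x e_irr e_drg e_bip theta_eig).
have thD : theta D = - k%:R by rewrite -th0 -thN ?subn0.
(* Used with [s = 1] for [i = 0] and [s = -1] for [i = D]. As [E i *m w] lies in [W] and
   [E*_0 W = 0], its entry at [x] vanishes, and hence all its entries do. *)
have E_end s i : (i <= D)%N -> s ^+ 2 = 1 -> theta i = s * k%:R ->
    mx_img (E i) W = 0%VS.
  move=> iD s2 th_i; have [f [Ef _ f_rec]] := E_radial i iD.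
  apply/mx_img_eq0P => w wW.
  have f_sign := rec_sign x e_sym e_irr e_drg e_bip e_val f_rec s2 th_i.
  rewrite Ef; apply: (radial_sign_mul0 (x := x) e_drg e_bip s2 f_sign).
  have EwW : E i *m w \in W by apply: (subvP (E_W i iD)); apply: mem_mx_img.
  have /mx_img_eq0P/(_ _ EwW)/colP/(_ (enum_rank x)) := W_end 0%N isT.
  by rewrite mul_dual_idem enum_rankK distxx eqxx mul1r Ef => ->; rewrite mxE.
have E0W : mx_img (E 0%N) W = 0%VS.
  by apply: (E_end 1) => //; rewrite ?expr1n // mul1r.
have EDW : mx_img (E D) W = 0%VS.
  by apply: (E_end (-1)) => //; rewrite ?sqrrN ?expr1n // mulN1r.
(* [E 0] is a nonzero constant matrix, so [E 0 *m v = 0] says that the entries of [v] add up to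
   zero. *)
have v_sum : \sum_a v a 0 = 0.
  have [f [Ef f0 f_rec]] := E_radial 0%N isT.
  have f_const h : (h <= D)%N -> f h = f 0%N.
    move=> hD.
    by rewrite (rec_sign x e_sym e_irr e_drg e_bip e_val f_rec
      (s := 1) _ _ hD) ?expr1n ?mul1r.
  have /mx_img_eq0P/(_ _ vW)/colP/(_ (enum_rank x))/eqP := E0W.
  rewrite Ef !mxE; under eq_bigr => b _ do rewrite mxE f_const ?dist_le_diameter //.
  by rewrite -mulr_sumr mulf_eq0 (gt_eqF f0) => /eqP.
have v_local a : dist e x (enum_val a) = 2 ->
    (dist_mx R[i] e 2 *m v) a 0 = eta * v a 0.
  move=> xa; have dual_v : dual_idem R[i] e x 2 *m v = v.
    apply/colP => b; rewrite mul_dual_idem.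
    by have [|/v_supp->] := eqVneq; rewrite ?mulr0 ?mul1r.
  move/colP/(_ a): v_eta; rewrite -!mulmxA dual_v mul_dual_idem xa eqxx mul1r.
  by rewrite [RHS]mxE.
pose m i := E i (enum_rank x) (enum_rank x).
have mE i f : E i = radial_mx e f -> m i = f 0%N.
  by rewrite /m => ->; rewrite radial_mxE distxx.
have m_gt0 i : (i <= D)%N -> 0 < m i.
  by move=> iD; have [f [/mE-> f0 _]] := E_radial i iD.
set b1 := (b_ p 1)%:R : R[i]; set b2 := (b_ p 2)%:R : R[i].
set b3 := (b_ p 3)%:R : R[i]; set K := k%:R : R[i] in th0 thD E_end.
have weighted_sum : \sum_(i < D.+1)
    m i * (K ^+ 2 - theta i ^+ 2) * (theta i ^+ 2 - b2) = 0.
  (* By [rec_12] and [rec_24] each term is a fixed multiple of [f 2 - f 4], a difference of entries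
     of [E i] at distances 2 and 4. Summed over [i] these become off-diagonal entries of the
     identity. *)
  have [y2 [z2 d2]] := dist_attained e_irr e_conn x (h := 2) ltac:(lia).
  have [y4 [z4 d4]] := dist_attained e_irr e_conn x (h := 4) ltac:(lia).
  transitivity (\sum_(i < D.+1) K * b1 * b2 * b3 *
    (E i (enum_rank y2) (enum_rank z2) - E i (enum_rank y4) (enum_rank z4))).
    apply: eq_bigr => i _; have iD : (i <= D)%N by rewrite -ltnS.
    have [f [Ef _ f_rec]] := E_radial i iD.
    have r12 := rec_12 x e_sym e_irr e_drg e_bip e_val f_rec D4.
    have r24 := rec_24 x e_sym e_irr e_drg e_bip e_val f_rec D4.
    rewrite (mE i f Ef) Ef !radial_mxE d2 d4 -/K -/b1 -/b2 -/b3 in r12 r24 *.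
    by rewrite [f 0%N * _]mulrC -r12 -!mulrA [(b2 * _)]mulrA r24; ring.
  rewrite -mulr_sumr sumrB -!summxE E_sum !mxE !(inj_eq enum_rank_inj).
  by rewrite -!(dist_eq0 e_conn) d2 d4 subrr mulr0.
have E_neq0 i : (1 <= i <= D - 1)%N ->
    b2 * b3 + (1 + eta) * (theta i ^+ 2 - b2) != 0 ->
    mx_img (E i) W <> 0%VS.
  move=> i_mid bound_neq0 /mx_img_eq0P/(_ v vW) Ev.
  have iD : (i <= D)%N by lia.
  have [f [Ef f0 f_rec]] := E_radial i iD.
  have r12 := rec_12 x e_sym e_irr e_drg e_bip e_val f_rec D4.
  have r24 := rec_24 x e_sym e_irr e_drg e_bip e_val f_rec D4.
  rewrite -/K -/b1 -/b2 -/b3 in r12 r24.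
  have [a va] : exists a, v a 0 != 0.
    apply/existsP; rewrite -negb_forall; apply: contra v_neq0 => /forallP v0.
    by apply/eqP/colP => a; rewrite mxE; apply/eqP/v0.
  have xa : dist e x (enum_val a) = 2 by apply/eqP; apply: contraNT va => /v_supp->.
  have := radial_mul_sphere2 e_sym e_drg e_bip f v_supp v_sum v_local xa.
  rewrite -Ef Ev mxE => /esym/eqP; rewrite mulf_eq0 (negPf va) orbF => /eqP mu0.
  have K_th : K ^+ 2 - theta i ^+ 2 != 0.
    rewrite subr_sqr mulf_neq0 //.
      by rewrite subr_eq0 -th0 gt_eqF //; apply: (proj2 theta_eig); lia.
    rewrite addrC -[K]opprK -thD subr_eq0 gt_eqF //.
    by apply: (proj2 theta_eig); lia.
  (* By [rec_12] and [rec_24] this product is [K b1 b2 b3] times the scalar by which [E i] acts on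
     [v] over the second sphere, while none of its factors is zero. *)
  have : (K ^+ 2 - theta i ^+ 2) * f 0%N *
      (b2 * b3 + (1 + eta) * (theta i ^+ 2 - b2)) = 0.
    rewrite -r12; transitivity (K * b1 * (b2 * b3) *
      (f 0%N - f 2 + (1 + eta) * (f 2 - f 4))); last by rewrite mu0 mulr0.
    transitivity (K * b1 * (b2 * b3 * (f 0%N - f 2) +
      (1 + eta) * ((f 0%N - f 2) * (theta i ^+ 2 - b2)))); first by ring.
    by rewrite -r24; ring.
  by move/eqP; rewrite !mulf_eq0 (negPf K_th) (gt_eqF f0) (negPf bound_neq0).
(* [local_bound_gt0] lives in an ordered field, so all quantities are carried over to their real
   parts in [R]. *)
pose t i := complex.Re (theta i).
have tC i : (i <= D)%N -> theta i = (t i)%:C%C.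
  move=> iD; rewrite RRe_real //.
  exact: (theta_real x e_sym e_irr e_drg e_val theta_eig iD).
have mC i : (i <= D)%N -> m i = (complex.Re (m i))%:C%C.
  by move=> iD; rewrite RRe_real // gtr0_real ?m_gt0.
have real_complexP (s : R) : s%:C%C \is Num.real.
  by rewrite realE -(rmorph0 (real_complex R)) !lecR -realE num_real.
pose B : R := (b_ p 2)%:R * (b_ p 3)%:R; pose b : R := (b_ p 2)%:R.
have tildeC (s : R) :
    theta_tilde p s%:C%C = (-1 - B * (s ^+ 2 - b)^-1)%:C%C.
  by rewrite /theta_tilde rmorphB rmorphN1 rmorphM fmorphV rmorphB rmorphXn rmorphM
    !rmorph_nat.
(* A strict inequality in [R[i]] makes the difference of its two sides real. *)
have eta_real : eta \is Num.real.
  rewrite -(subrK (theta_tilde p (theta 1%N)) eta) realD //.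
    by rewrite gtr0_real // subr_gt0.
  by rewrite tC ?tildeC //; lia.
have etaC : eta = (complex.Re eta)%:C%C by rewrite RRe_real.
move: (complex.Re eta) etaC => eta' etaC.
have bound_neq0 i : (1 <= i <= D - 1)%N ->
    b2 * b3 + (1 + eta) * (theta i ^+ 2 - b2) != 0.
  move=> i_mid.
  have bound_gt0 : 0 < B + (1 + eta') * (t i ^+ 2 - b).
    apply: (@local_bound_gt0 _ D t (fun j => complex.Re (m j)) k%:R) i_mid => //.
    - by rewrite mulr_ge0 ?ler0n.
    - by move=> j l jl; rewrite -ltcR -!tC; [apply: (proj2 theta_eig)| lia..].
    - by move=> j jD; apply: complexI; rewrite rmorphN /= -!tC ?thN ?leq_subr.
    - by apply: complexI; rewrite -tC // th0 rmorph_nat.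
    - by move=> j jD; rewrite -ltcR -mC ?m_gt0.
    - apply: complexI; rewrite rmorph0 -weighted_sum rmorph_sum.
      apply: eq_bigr => j _; have jD : (j <= D)%N by rewrite -ltnS.
      by rewrite !rmorphM !rmorphB !rmorphXn !rmorph_nat /= -mC -?tC.
    - by rewrite -ltcR -tildeC -etaC -tC //; lia.
    - by rewrite -ltcR -tildeC -etaC -tC //; lia.
  have -> : b2 * b3 + (1 + eta) * (theta i ^+ 2 - b2) =
      (B + (1 + eta') * (t i ^+ 2 - b))%:C%C.
    rewrite etaC tC; last lia.
    by rewrite /B /b rmorphD !rmorphM rmorphD rmorphB rmorphXn rmorph1 !rmorph_nat.
  by rewrite fmorph_eq0 gt_eqF.
have [dimW dim_dual dim_E] : [/\ \dim W = (D - 1)%N,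
    forall i, (i <= D)%N -> \dim (mx_img (dual_idem R[i] e x i) W) = (2 <= i)%N &
    forall i, (i <= D)%N -> \dim (mx_img (E i) W) = (1 <= i <= D - 1)%N].
  (* Thinness and the endpoint bound the [E*_i W] from above; the nonvanishing of [E_i W] for
     [0 < i < D] bounds those from below. *)
  apply: dims_of_sums.
  - by lia.
  - apply: dim_orthogonal_idempotents => //; last exact: sum_dual_idem.
    by move=> i j _ _; apply: dual_idemM.
  - exact: dim_orthogonal_idempotents.
  - move=> i iD; case: (leqP 2 i) => [_|i2]; first exact: thinW.
    by rewrite W_end // dimv0.
  - move=> i iD; case: (boolP (1 <= i <= D - 1)%N) => // i_mid.
    by rewrite lt0n dimv_eq0; apply/eqP/E_neq0/bound_neq0.
split=> // i iD; split.
- by rewrite !inE => i01; apply: W_end; lia.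
- by move=> i2; rewrite dim_dual // (proj1 (andP i2)).
- by rewrite !inE => /orP[] /eqP->.
- by move=> i_mid; rewrite dim_E // i_mid.
Qed.
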